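(* Suppose $(G,P,\theta)$ is an algebraic dynamical system for which $P$ is directed. If $(G,P,\theta)$ is minimal, that is, $\bigcap_{p\in P}\theta_p(G)=\{1_G\}$ holds, then the canonical representation $\pi\colon\mathcal{Q}(G\rtimes_\theta P)\to\mathcal{L}(\ell^2(G))$ is irreducible.
   Context: An algebraic dynamical system is a triple $(G,P,\theta)$ where $G$ is a countable discrete group; $P$ is a right LCM semigroup, i.e. a countable left cancellative monoid in which the intersection of two principal right ideals is either empty or another principal right ideal; and $\theta$ is an action of $P$ on $G$ by injective group endomorphisms $\theta_p$ which respects the order: $pP\cap qP=rP$ implies $\theta_p(G)\cap\theta_q(G)=\theta_r(G)$. $P$ is directed if it is directed with respect to $p\geq q \Leftrightarrow p\in qP$, i.e. $pP\cap qP\neq\emptyset$ for all $p,q\in P$. Write $N_p=[G:\theta_p(G)]$. For directed $P$, the boundary quotient $\mathcal{Q}(G\rtimes_\theta P)$ is the universal $C^*$-algebra generated by a unitary representation $u$ of $G$ and a representation $s$ of the monoid $P$ by isometries satisfying (I) $s_pu_g=u_{\theta_p(g)}s_p$; (II) $s_p^*u_gs_q=u_{g_1}s_{p'}s_{q'}^*u_{g_2}$ if $g=\theta_p(g_1)\theta_q(g_2)$ and $pP\cap qP=pp'P$, $pp'=qq'$, and $s_p^*u_gs_q=0$ otherwise; (III) $\sum_{[g]\in G/\theta_p(G)}u_gs_ps_p^*u_g^*=1$ whenever $N_p<\infty$. The canonical representation $\pi\colon\mathcal{Q}(G\rtimes_\theta P)\to\mathcal{L}(\ell^2(G))$ is given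 by $\pi(u_gs_p)\xi_h=\xi_{g\theta_p(h)}$, where $(\xi_h)_{h\in G}$ is the standard orthonormal basis of $\ell^2(G)$. *)

(* Defs.v *)
From HB Require Import structures.
From mathcomp Require Import all_boot all_order all_algebra.
From mathcomp Require Import complex finmap.
From mathcomp Require Import boolp classical_sets functions cardinality fsbigop.
From mathcomp Require Import reals ereal topology normedtype esum.
From mathcomp Require Import ring lra.

(* Written over Mathematical Components and MathComp-Analysis, with the field
   of complex numbers R[i] over an arbitrary R : realType. *)

Set Implicit Arguments.
Unset Strict Implicit.
Unset Printing Implicit Defensive.

Import Order.TTheory GRing.Theory Num.Theory.
Import numFieldNormedType.Exports.
Local Open Scope classical_set_scope.
Local Open Scope ring_scope.
Local Open Scope complex_scope.

(* The norm of a normedModType over R[i] takes its values in R[i]. *)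
HB.mixin Record CompleteNormedModule_isHilbert (R : realType) H
    & CompleteNormedModule R[i] H := {
  inner : H -> H -> R[i];
  innerDl : forall x y z, inner (x + y) z = inner x z + inner y z;
  innerZl : forall (a : R[i]) x y, inner (a *: x) y = a * inner x y;
  innerC : forall x y, inner y x = Num.conj (inner x y);
  sqr_norm_inner : forall x, `|x| ^+ 2 = inner x x
}.

#[short(type="hilbertType")]
HB.structure Definition Hilbert (R : realType) :=
  {H of CompleteNormedModule R[i] H & CompleteNormedModule_isHilbert R H}.

(* Unital C*-algebras. The product is a separate operation [cmul] because
   Num.NumDomain is the only structure of the library joining a ring with a
   norm, so a noncommutative normed algebra cannot inherit from both. *)
HB.mixin Record CompleteNormedModule_isCStar (R : realType) A
    & CompleteNormedModule R[i] A := {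
  cone : A;
  cmul : A -> A -> A;
  star : A -> A;
  cmulA : associative cmul;
  cmul1x : left_id cone cmul;
  cmulx1 : right_id cone cmul;
  cmulDl : left_distributive cmul +%R;
  cmulDr : right_distributive cmul +%R;
  cmulZl : forall (a : R[i]) x y, cmul (a *: x) y = a *: cmul x y;
  cmulZr : forall (a : R[i]) x y, cmul x (a *: y) = a *: cmul x y;
  starD : {morph star : x y / x + y};
  starZ : forall (a : R[i]) x, star (a *: x) = Num.conj a *: star x;
  starM : forall x y, star (cmul x y) = cmul (star y) (star x);
  starK : involutive star;
  ler_norm_cmul : forall x y, `|cmul x y| <= `|x| * `|y|;
  norm_star_cmul : forall x, `|cmul (star x) x| = `|x| ^+ 2
}.

#[short(type="cstarAlgType")]
HB.structure Definition CStarAlgebra (R : realType) :=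
  {A of CompleteNormedModule R[i] A & CompleteNormedModule_isCStar R A}.

Section real_sums.
Variables (R : realType) (I : choiceType).
Implicit Types (x y p q : I -> R) (a : R).

Definition nnsum p : \bar R := \esum_(i in [set: I]) (p i)%:E.

(* The value is meaningful only if x is absolutely summable. *)
Definition rsum x : R :=
  fine (nnsum (fun i => Num.max (x i) 0)) -
  fine (nnsum (fun i => Num.max (- x i) 0)).

Lemma nnsum_ge0 p : (forall i, 0 <= p i) -> (0 <= nnsum p)%E.
Proof. by move=> p0; apply: esum_ge0 => i _; rewrite lee_fin. Qed.

Lemma nnsum_fin p : (forall i, 0 <= p i) -> (nnsum p < +oo)%E ->
  nnsum p \is a fin_num.
Proof. by move=> p0 pfin; rewrite ge0_fin_numE// nnsum_ge0. Qed.

Lemma le_nnsum p q : (forall i, p i <= q i) -> (nnsum p <= nnsum q)%E.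
Proof. by move=> pq; apply: le_esum => i _; rewrite lee_fin. Qed.

Lemma nnsumD p q : (forall i, 0 <= p i) -> (forall i, 0 <= q i) ->
  nnsum (fun i => p i + q i) = (nnsum p + nnsum q)%E.
Proof.
by move=> p0 q0; rewrite /nnsum -esumD// => i _; rewrite lee_fin.
Qed.

Lemma nnsum0 : nnsum (fun=> 0) = 0%E.
Proof. by apply: esum1. Qed.

Lemma nnsum_leZ a p : 0 <= a -> (forall i, 0 <= p i) ->
  (nnsum (fun i => a * p i)%R <= a%:E * nnsum p)%E.
Proof.
move=> a0 p0; apply: ge_ereal_sup => _ [F [finF _] <-].
rewrite fsumEFin// -mulr_fsumr EFinM -fsumEFin//.
apply: lee_wpmul2l; first by rewrite lee_fin.
by apply: ereal_sup_ubound; exists F.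
Qed.

Lemma nnsumZ a p : 0 <= a -> (forall i, 0 <= p i) ->
  nnsum (fun i => a * p i) = (a%:E * nnsum p)%E.
Proof.
move=> a0 p0; apply/eqP; rewrite eq_le nnsum_leZ//=.
have [->|a_neq0] := eqVneq a 0.
  by rewrite mul0e nnsum_ge0// => i; rewrite mul0r.
have {a_neq0}a0 : 0 < a by rewrite lt_def a_neq0.
have := @nnsum_leZ a^-1 (fun i => a * p i).
rewrite invr_ge0 ltW// => /(_ isT) H.
have {}H := H (fun i => mulr_ge0 (ltW a0) (p0 i)).
rewrite -lee_pdivlMl//.
apply: le_trans H.
by apply: le_nnsum => i; rewrite mulrA mulVf ?gt_eqF// mul1r.
Qed.

Lemma fine_nnsumD p q : (forall i, 0 <= p i) -> (forall i, 0 <= q i) ->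
  (nnsum p < +oo)%E -> (nnsum q < +oo)%E ->
  fine (nnsum (fun i => p i + q i)) = fine (nnsum p) + fine (nnsum q).
Proof. by move=> p0 q0 ps qs; rewrite nnsumD// fineD// nnsum_fin. Qed.

Lemma fine_nnsumZ a p : 0 <= a -> (forall i, 0 <= p i) ->
  (nnsum p < +oo)%E ->
  fine (nnsum (fun i => a * p i)) = a * fine (nnsum p).
Proof. by move=> a0 p0 ps; rewrite nnsumZ// fineM// nnsum_fin. Qed.

Lemma rsum_decomp x p q : (forall i, 0 <= p i) -> (forall i, 0 <= q i) ->
  (nnsum p < +oo)%E -> (nnsum q < +oo)%E ->
  (forall i, x i = p i - q i) -> rsum x = fine (nnsum p) - fine (nnsum q).
Proof.
move=> p0 q0 ps qs xE.
have m0 y i : 0 <= Num.max (y i) 0 :> R by rewrite le_max lexx orbT.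
have xps : (nnsum (fun i => Num.max (x i) 0)%R < +oo)%E.
  apply: le_lt_trans ps; apply: le_nnsum => i; rewrite ge_max p0 andbT xE.
  by rewrite gerBl.
have xns : (nnsum (fun i => Num.max (- x i) 0)%R < +oo)%E.
  apply: le_lt_trans qs; apply: le_nnsum => i; rewrite ge_max q0 andbT xE opprB.
  by rewrite gerBl.
have : fine (nnsum (fun i => Num.max (x i) 0 + q i)) =
       fine (nnsum (fun i => p i + Num.max (- x i) 0)).
  congr (fine (nnsum _)); apply/funext => i; rewrite xE.
  by case: (leP (p i - q i) 0) => h; case: (leP (- (p i - q i)) 0) => h'; lra.
rewrite (fine_nnsumD (m0 x) q0 xps qs).
rewrite (fine_nnsumD p0 (m0 (fun i => - x i)) ps xns) => h.
by rewrite /rsum; lra.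
Qed.

Definition rsummable x := (nnsum (fun i => `|x i|)%R < +oo)%E.

Lemma rsummable_le x p : (forall i, `|x i| <= p i) -> (nnsum p < +oo)%E ->
  rsummable x.
Proof. by move=> xp; apply: le_lt_trans; exact: le_nnsum. Qed.

Lemma rsum_dec x : rsummable x -> exists p q,
  [/\ forall i, 0 <= p i, forall i, 0 <= q i, (nnsum p < +oo)%E,
  (nnsum q < +oo)%E & forall i, x i = p i - q i].
Proof.
move=> xs; exists (fun i => Num.max (x i) 0), (fun i => Num.max (- x i) 0); split.
- by move=> i; rewrite le_max lexx orbT.
- by move=> i; rewrite le_max lexx orbT.
- by apply: le_lt_trans xs; apply: le_nnsum => i; rewrite ge_max ler_norm normr_ge0.
- apply: le_lt_trans xs; apply: le_nnsum => i.
  by rewrite ge_max normr_ge0 andbT -normrN ler_norm.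
- by move=> i; case: (leP (x i) 0) => h; case: (leP (- x i) 0) => h'; lra.
Qed.

Lemma rsum_ge0 p : (forall i, 0 <= p i) -> (nnsum p < +oo)%E ->
  rsum p = fine (nnsum p).
Proof.
move=> p0 ps; rewrite (@rsum_decomp p p (fun=> 0))// ?nnsum0 ?subr0//.
by move=> i; rewrite subr0.
Qed.

Lemma rsumD x y : rsummable x -> rsummable y ->
  rsum (fun i => x i + y i) = rsum x + rsum y.
Proof.
move=> /rsum_dec[p [q [p0 q0 ps qs xE]]] /rsum_dec[p' [q' [p'0 q'0 p's q's yE]]].
rewrite (rsum_decomp p0 q0 ps qs xE) (rsum_decomp p'0 q'0 p's q's yE).
rewrite (@rsum_decomp _ (fun i => p i + p' i) (fun i => q i + q' i)).
- by rewrite (fine_nnsumD p0 p'0 ps p's) (fine_nnsumD q0 q'0 qs q's) opprD addrACA.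
- by move=> i; rewrite addr_ge0.
- by move=> i; rewrite addr_ge0.
- by rewrite nnsumD// lte_add_pinfty.
- by rewrite nnsumD// lte_add_pinfty.
- move=> i; rewrite xE yE; lra.
Qed.

Lemma rsumN x : rsum (fun i => - x i) = - rsum x.
Proof.
rewrite /rsum opprB; congr (_ - fine (nnsum _)).
by apply/funext => i; rewrite opprK.
Qed.

Lemma rsumZ a x : rsummable x -> rsum (fun i => a * x i) = a * rsum x.
Proof.
wlog a0 : a / 0 <= a.
  move=> H xs; have [/H->//|/ltW a0] := leP 0 a.
  rewrite -[in RHS](opprK a) mulNr -H ?oppr_ge0// -rsumN.
  by congr rsum; apply/funext => i; rewrite mulNr opprK.
move=> /rsum_dec[p [q [p0 q0 ps qs xE]]].
rewrite (rsum_decomp p0 q0 ps qs xE).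
rewrite (@rsum_decomp _ (fun i => a * p i) (fun i => a * q i)).
- by rewrite (fine_nnsumZ a0 p0 ps) (fine_nnsumZ a0 q0 qs) mulrBr.
- by move=> i; rewrite mulr_ge0.
- by move=> i; rewrite mulr_ge0.
- by rewrite nnsumZ// lte_mul_pinfty// lee_fin.
- by rewrite nnsumZ// lte_mul_pinfty// lee_fin.
- move=> i; rewrite xE; lra.
Qed.

End real_sums.

Section ell2.
Variables (R : realType) (I : choiceType).
Implicit Types (f g h : I -> R[i]^o).

Definition sqmod (z : R[i]) : R := complex.Re z ^+ 2 + complex.Im z ^+ 2.

Lemma sqmod_ge0 z : 0 <= sqmod z.
Proof. by rewrite addr_ge0// sqr_ge0. Qed.

Lemma sqmodE z : (sqmod z)%:C = `|z| ^+ 2.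
Proof. by rewrite normc_def -rmorphXn/= sqr_sqrtr ?sqmod_ge0. Qed.

Lemma sqmod_add z w : sqmod (z + w) <= 2 * sqmod z + 2 * sqmod w.
Proof. case: z w => [a b] [c d]; rewrite /sqmod/= -subr_ge0.
rewrite (_ : _ - _ = (a - c) ^+ 2 + (b - d) ^+ 2); last by ring.
by rewrite addr_ge0// sqr_ge0.
Qed.

Lemma sqmodM z w : sqmod (z * w) = sqmod z * sqmod w.
Proof. case: z w => [a b] [c d]; rewrite /sqmod/=; ring. Qed.

Definition ell2_pred : {pred I -> R[i]^o} :=
  fun f => `[< (\esum_(i in [set: I]) (sqmod (f i))%:E < +oo)%E >].

Lemma ell2_predP f : reflect (nnsum (fun i => sqmod (f i)) < +oo)%E (f \in ell2_pred).
Proof. exact: asboolP. Qed.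

Lemma ell2_submod_closed : submod_closed ell2_pred.
Proof.
split.
  apply/ell2_predP; rewrite (_ : nnsum _ = 0%E)//.
  rewrite -[RHS](nnsum0 R I); congr nnsum; apply/funext => i.
  by rewrite /sqmod /= !expr0n addr0.
move=> a f g /ell2_predP fs /ell2_predP gs; apply/ell2_predP.
apply: (@le_lt_trans _ _ (nnsum (fun i => 2 * sqmod a * sqmod (f i) + 2 * sqmod (g i)))%R).
  apply: le_nnsum => i; apply: le_trans (sqmod_add _ _) _.
  by rewrite sqmodM mulrA.
rewrite nnsumD; first last.
- by move=> i; rewrite mulr_ge0 ?sqmod_ge0.
- by move=> i; rewrite !mulr_ge0 ?sqmod_ge0.
rewrite !nnsumZ ?mulr_ge0 ?sqmod_ge0//; try by move=> i; exact: sqmod_ge0.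
by rewrite lte_add_pinfty// lte_mul_pinfty// lee_fin ?mulr_ge0 ?sqmod_ge0.
Qed.

HB.instance Definition _ :=
  GRing.isSubmodClosed.Build R[i] (I -> R[i]^o) ell2_pred ell2_submod_closed.

Record ell2 := Ell2 { ell2_fun :> I -> R[i]^o; _ : ell2_fun \in ell2_pred }.

HB.instance Definition _ := [isSub for ell2_fun].
HB.instance Definition _ := [Choice of ell2 by <:].
HB.instance Definition _ := [SubChoice_isSubLmodule of ell2 by <:].

Definition ell2_inner (f g : ell2) : R[i] :=
  let h i := f i * Num.conj (g i) in
  rsum (fun i => complex.Re (h i)) +i* rsum (fun i => complex.Im (h i)).

Definition ell2_norm (f : ell2) : R :=
  Num.sqrt (fine (\esum_(i in [set: I]) (sqmod (f i))%:E)%E).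

Implicit Types u v w : ell2.

Lemma ell2_fin u : (nnsum (fun i => sqmod (u i)) < +oo)%E.
Proof. by apply/ell2_predP; case: u. Qed.

Lemma ell2D u v i : (u + v) i = u i + v i. Proof. by []. Qed.
Lemma ell2Z a u i : (a *: u) i = a * u i. Proof. by []. Qed.

Lemma conjcE (z : R[i]) : Num.conj z = complex.Re z -i* complex.Im z.
Proof. by case: z. Qed.

Lemma ell2_innerE u v : ell2_inner u v =
  rsum (fun i => complex.Re (u i) * complex.Re (v i) + complex.Im (u i) * complex.Im (v i)) +i*
  rsum (fun i => complex.Im (u i) * complex.Re (v i) - complex.Re (u i) * complex.Im (v i)).
Proof.
rewrite /ell2_inner/=; congr Complex; congr rsum; apply/funext => i; rewrite conjcE;
  case: (u i) (v i) => [a b] [c d] /=; ring.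
Qed.

Let prod_summable (x y : I -> R[i]) : (nnsum (fun i => sqmod (x i)) < +oo)%E ->
  (nnsum (fun i => sqmod (y i)) < +oo)%E ->
  rsummable (fun i => complex.Re (x i) * complex.Re (y i) + complex.Im (x i) * complex.Im (y i)) /\
  rsummable (fun i => complex.Im (x i) * complex.Re (y i) - complex.Re (x i) * complex.Im (y i)).
Proof.
move=> xs ys.
have H : (nnsum (fun i => sqmod (x i) + sqmod (y i))%R < +oo)%E.
  by rewrite nnsumD ?lte_add_pinfty// => i; exact: sqmod_ge0.
have P (a b c d : R) : `|a * c + b * d| <= (a ^+ 2 + b ^+ 2) + (c ^+ 2 + d ^+ 2).
  rewrite ler_norml.
  have := (sqr_ge0 (a - c), sqr_ge0 (a + c), sqr_ge0 (b - d), sqr_ge0 (b + d)).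
  move=> [] [] [] h1 h2 h3 h4; rewrite !expr2 in h1 h2 h3 h4 *.
  by apply/andP; split; nra.
split; apply: rsummable_le H => i; first exact: P.
have := P (complex.Im (x i)) (- complex.Re (x i)) (complex.Re (y i)) (complex.Im (y i)).
by rewrite mulNr sqrrN [X in _ <= X + _]addrC.
Qed.

Lemma ell2_innerDl u v w : ell2_inner (u + v) w = ell2_inner u w + ell2_inner v w.
Proof.
have [ru iu] := prod_summable (ell2_fin u) (ell2_fin w).
have [rv iv] := prod_summable (ell2_fin v) (ell2_fin w).
rewrite !ell2_innerE /=; apply/eqP; rewrite eq_complex /= -!rsumD//.
have P1 (z t s : R[i]) : complex.Re (z + t) * complex.Re s + complex.Im (z + t) * complex.Im s =
    complex.Re z * complex.Re s + complex.Im z * complex.Im s +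
    (complex.Re t * complex.Re s + complex.Im t * complex.Im s).
  by case: z t s => [a b] [c d] [e f] /=; ring.
have P2 (z t s : R[i]) : complex.Im (z + t) * complex.Re s - complex.Re (z + t) * complex.Im s =
    complex.Im z * complex.Re s - complex.Re z * complex.Im s +
    (complex.Im t * complex.Re s - complex.Re t * complex.Im s).
  by case: z t s => [a b] [c d] [e f] /=; ring.
by apply/andP; split; apply/eqP; congr rsum; apply/funext => i; [exact: P1|exact: P2].
Qed.

Lemma ell2_innerZl a u v : ell2_inner (a *: u) v = a * ell2_inner u v.
Proof.
have [ru iu] := prod_summable (ell2_fin u) (ell2_fin v).
rewrite !ell2_innerE /=; case: a => [a b]; apply/eqP; rewrite eq_complex /=.
have zs (x : I -> R) (c : R) : rsummable x -> rsummable (fun i : I => c * x i).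
  move=> xs; apply: (@rsummable_le _ _ _ (fun i => `|c| * `|x i|)).
    by move=> i; rewrite normrM.
  by rewrite nnsumZ// lte_mul_pinfty// lee_fin.
have nzs (x : I -> R) (c : R) : rsummable x -> rsummable (fun i : I => - (c * x i)).
  move=> xs; have -> : (fun i => - (c * x i)) = fun i => - c * x i.
    by apply/funext => i; rewrite mulNr.
  exact: zs.
rewrite -(rsumZ a ru) -(rsumZ b iu) -(rsumZ a iu) -(rsumZ b ru) -rsumN.
rewrite -(rsumD (zs _ a ru) (nzs _ b iu)) -(rsumD (zs _ a iu) (zs _ b ru)).
have P1 (z s : R[i]) : complex.Re ((a +i* b) * z) * complex.Re s + complex.Im ((a +i* b) * z) * complex.Im s =
    a * (complex.Re z * complex.Re s + complex.Im z * complex.Im s) -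
    b * (complex.Im z * complex.Re s - complex.Re z * complex.Im s).
  by case: z s => [c d] [e f] /=; ring.
have P2 (z s : R[i]) : complex.Im ((a +i* b) * z) * complex.Re s - complex.Re ((a +i* b) * z) * complex.Im s =
    a * (complex.Im z * complex.Re s - complex.Re z * complex.Im s) +
    b * (complex.Re z * complex.Re s + complex.Im z * complex.Im s).
  by case: z s => [c d] [e f] /=; ring.
by apply/andP; split; apply/eqP; congr rsum; apply/funext => i; [exact: P1|exact: P2].
Qed.

Lemma ell2_innerC u v : ell2_inner v u = Num.conj (ell2_inner u v).
Proof.
rewrite conjcE !ell2_innerE /= -rsumN; congr Complex; congr rsum;
  apply/funext => i; ring.
Qed.

Lemma ell2_norm_ge0 u : 0 <= ell2_norm u. Proof. exact: sqrtr_ge0. Qed.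

Lemma sqr_ell2_norm u : ell2_norm u ^+ 2 = fine (nnsum (fun i => sqmod (u i))).
Proof.
by rewrite sqr_sqrtr// fine_ge0// nnsum_ge0// => i; exact: sqmod_ge0.
Qed.

Lemma ell2_inner_norm u : (ell2_norm u)%:C ^+ 2 = ell2_inner u u.
Proof.
rewrite -rmorphXn/= sqr_ell2_norm ell2_innerE; apply/eqP.
rewrite eq_complex/=; apply/andP; split.
  rewrite -(rsum_ge0 _ (ell2_fin u)); last by move=> i; exact: sqmod_ge0.
  by apply/eqP; congr rsum; apply/funext => i; rewrite /sqmod !expr2.
rewrite (_ : (fun i => _) = (fun=> 0)) ?rsum_ge0 ?nnsum0//=.
by apply/funext => i; ring.
Qed.

Lemma ell2_normZ a u : (ell2_norm (a *: u))%:C = `|a| * (ell2_norm u)%:C.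
Proof.
apply/eqP; rewrite -(@eqrXn2 _ 2)//; last 2 first.
- by rewrite ler0c ell2_norm_ge0.
- by rewrite mulr_ge0// ler0c ell2_norm_ge0.
rewrite exprMn -sqmodE -!rmorphXn/= -rmorphM/= !sqr_ell2_norm.
rewrite -fine_nnsumZ ?sqmod_ge0 ?ell2_fin//; last by move=> i; exact: sqmod_ge0.
by apply/eqP; congr (fine (nnsum _))%:C; apply/funext => i; rewrite ell2Z sqmodM.
Qed.

Lemma ell2_norm0_eq0 u : ell2_norm u = 0 -> u = 0.
Proof.
move=> u0; have := sqr_ell2_norm u; rewrite u0 expr0n/= => /esym s0.
have {}s0 : nnsum (fun i => sqmod (u i)) = 0%E.
  rewrite -[LHS]fineK ?s0// nnsum_fin ?ell2_fin// => i; exact: sqmod_ge0.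
apply/val_inj/funext => i /=.
have : ((sqmod (u i))%:E <= 0)%E.
  rewrite -s0; apply: ereal_sup_ubound; exists [set i] => //.
  by rewrite fsbig_set1.
rewrite lee_fin /sqmod => h; apply/eqP; rewrite eq_complex /=.
have := (sqr_ge0 (complex.Re (u i)), sqr_ge0 (complex.Im (u i))) => -[hr hi].
rewrite -(sqrf_eq0 (complex.Re _)) -(sqrf_eq0 (complex.Im _)).
by apply/andP; split; apply/eqP; lra.
Qed.

Lemma ell2_norm_sqD u v : ell2_norm (u + v) ^+ 2 =
  ell2_norm u ^+ 2 + ell2_norm v ^+ 2 + 2 * complex.Re (ell2_inner u v).
Proof.
have h w : ell2_norm w ^+ 2 = complex.Re (ell2_inner w w).
  by rewrite -ell2_inner_norm -rmorphXn.
have innerDr : ell2_inner (u + v) (u + v) = (ell2_inner u u + ell2_inner v v) +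
    (ell2_inner u v + Num.conj (ell2_inner u v)).
  rewrite ell2_innerDl (ell2_innerC (u + v) u) (ell2_innerC (u + v) v).
  rewrite !ell2_innerDl !rmorphD/= -!ell2_innerC.
  by ring.
rewrite !h innerDr conjcE.
case: (ell2_inner u u) (ell2_inner v v) (ell2_inner u v) => [a b] [c d] [e f] /=; ring.
Qed.

Lemma ell2_CS u v : complex.Re (ell2_inner u v) <= ell2_norm u * ell2_norm v.
Proof.
have H (a b : R) : 0 <= a ^+ 2 * ell2_norm u ^+ 2 + b ^+ 2 * ell2_norm v ^+ 2 -
    2 * (a * b * complex.Re (ell2_inner u v)).
  have := sqr_ge0 (ell2_norm (a%:C *: u + (- b)%:C *: v)).
  have nZ (c : R) w : ell2_norm (c%:C *: w) ^+ 2 = c ^+ 2 * ell2_norm w ^+ 2.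
    suff : (ell2_norm (c%:C *: w) ^+ 2)%:C = (c ^+ 2 * ell2_norm w ^+ 2)%:C by case.
    rewrite (rmorphXn (real_complex R)) /= ell2_normZ exprMn -sqmodE.
    rewrite -(rmorphXn (real_complex R)) -(rmorphM (real_complex R)).
    by rewrite /sqmod/= expr0n addr0.
  rewrite ell2_norm_sqD (nZ a u) (nZ (- b) v) sqrrN.
  have -> : ell2_inner (a%:C *: u) ((- b)%:C *: v) =
      a%:C * Num.conj ((- b)%:C * Num.conj (ell2_inner u v)).
    by rewrite ell2_innerZl (ell2_innerC ((- b)%:C *: v) u) ell2_innerZl (ell2_innerC u v).
  case: (ell2_inner u v) => [c d] /=; lra.
have := (ell2_norm_ge0 u, ell2_norm_ge0 v) => -[u0 v0].
have [uv0|uv0] := eqVneq (ell2_norm u * ell2_norm v) 0.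
  have : ell2_inner u v = 0.
    move/eqP: uv0; rewrite mulf_eq0 => /orP[] /eqP /ell2_norm0_eq0 ->.
      by rewrite -(scale0r 0) ell2_innerZl mul0r.
    by rewrite ell2_innerC -(scale0r 0) ell2_innerZl mul0r conjC0.
  by move=> ->; rewrite uv0.
have {}uv0 : 0 < ell2_norm u * ell2_norm v by rewrite lt_def uv0 mulr_ge0.
rewrite -(ler_pM2l uv0).
have := H (ell2_norm v) (ell2_norm u); nra.
Qed.

Lemma ell2_normD u v : ell2_norm (u + v) <= ell2_norm u + ell2_norm v.
Proof.
rewrite -(@ler_pXn2r _ 2)// ?nnegrE ?addr_ge0 ?ell2_norm_ge0//.
rewrite ell2_norm_sqD sqrrD.
have := ell2_CS u v; lra.
Qed.

End ell2.

Section ell2_hilbert.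
Variables (R : realType) (I : choiceType).
Local Notation H := (ell2 R I).
Implicit Types u v w : H.

Let normD u v : (ell2_norm (u + v))%:C <= (ell2_norm u)%:C + (ell2_norm v)%:C.
Proof. by rewrite -(rmorphD (real_complex R)) lecR ell2_normD. Qed.

Let norm0 u : (ell2_norm u)%:C = 0 -> u = 0.
Proof. by move=> [] /ell2_norm0_eq0. Qed.

HB.instance Definition _ := Lmodule_isNormed.Build R[i] H
  normD (@ell2_normZ R I) norm0.

Lemma ell2_normE u : `|u| = (ell2_norm u)%:C. Proof. by []. Qed.

Lemma ell2_normN u : ell2_norm (- u) = ell2_norm u.
Proof.
suff : (ell2_norm (- u))%:C = (ell2_norm u)%:C by case.
by rewrite -!ell2_normE normrN.
Qed.

Lemma ell2_ballE u (e : R) : ball u e%:C = [set v | ell2_norm (u - v) < e].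
Proof.
by rewrite -ball_normE; apply/funext => v; rewrite /ball_/= ell2_normE ltcR.
Qed.

Lemma sum_sqmod_le_norm u (A : set I) : finite_set A ->
  \sum_(i \in A) sqmod (u i) <= ell2_norm u ^+ 2.
Proof.
move=> finA; rewrite sqr_ell2_norm -lee_fin fineK; last first.
  by rewrite nnsum_fin ?ell2_fin// => i; exact: sqmod_ge0.
by rewrite -fsumEFin//; apply: ereal_sup_ubound; exists A.
Qed.

Lemma sqmod_le_norm u i : sqmod (u i) <= ell2_norm u ^+ 2.
Proof. by have := sum_sqmod_le_norm u (finite_set1 i); rewrite fsbig_set1. Qed.

Lemma Re_le_norm u i : `|complex.Re (u i)| <= ell2_norm u.
Proof.
rewrite -(@ler_pXn2r _ 2)// ?nnegrE ?ell2_norm_ge0// real_normK ?num_real//.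
by apply: le_trans (sqmod_le_norm u i); rewrite lerDl sqr_ge0.
Qed.

Lemma Im_le_norm u i : `|complex.Im (u i)| <= ell2_norm u.
Proof.
rewrite -(@ler_pXn2r _ 2)// ?nnegrE ?ell2_norm_ge0// real_normK ?num_real//.
by apply: le_trans (sqmod_le_norm u i); rewrite lerDr sqr_ge0.
Qed.

Lemma ell2_complete (F : set_system H) : ProperFilter F -> cauchy F -> cvg F.
Proof.
move=> FF /cauchyP cF.
have {}cF (e : R) : 0 < e -> exists u, \forall v \near F, ell2_norm (u - v) < e.
  move=> e0; have [|u Fu] := cF e%:C; first by rewrite ltcR.
  by exists u; move: Fu; rewrite ell2_ballE.
have coord (phi : H -> R) : (forall u v, phi (u - v) = phi u - phi v) ->
    (forall u, `|phi u| <= ell2_norm u) -> cvg (phi @ F).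
  move=> phiB phile; apply: R_complete; apply/cauchyP => e e0.
  have [u Fu] := cF _ e0; exists (phi u); rewrite -ball_normE.
  apply: filterS Fu => v uv /=.
  by rewrite -phiB (le_lt_trans (phile _)).
have cRe i : cvg ((fun u => complex.Re (u i)) @ F).
  apply: coord => [u v|u]; last exact: Re_le_norm.
  rewrite (_ : (u - v) i = u i - v i)//.
  by case: (u i) (v i) => [a b] [c d].
have cIm i : cvg ((fun u => complex.Im (u i)) @ F).
  apply: coord => [u v|u]; last exact: Im_le_norm.
  rewrite (_ : (u - v) i = u i - v i)//.
  by case: (u i) (v i) => [a b] [c d].
pose f i : R[i] := lim ((fun u => complex.Re (u i)) @ F) +i*
                   lim ((fun u => complex.Im (u i)) @ F).
have cvgS (g : I -> H -> R) (l : I -> R) (r : seq I) :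
    (forall i, g i @ F --> l i) ->
    (fun v => \sum_(i <- r) g i v) @ F --> \sum_(i <- r) l i.
  move=> gl; elim: r => [|i r IH].
    rewrite big_nil (_ : (fun v => _) = fun=> 0); first exact: cvg_cst.
    by apply/funext => v; rewrite big_nil.
  rewrite big_cons (_ : (fun v => _) = g i \+ (fun v => \sum_(j <- r) g j v)).
    exact: cvgD.
  by apply/funext => v; rewrite big_cons.
have key (e : R) u : 0 < e -> (\forall v \near F, ell2_norm (u - v) < e) ->
    (nnsum (fun i => sqmod (u i - f i))%R <= (e ^+ 2)%:E)%E.
  move=> e0 Fu; apply: ge_ereal_sup => _ [A [finA _] <-].
  rewrite fsumEFin// lee_fin.
  have : (fun v => \sum_(i \in A) sqmod (u i - v i)) @ F -->
      \sum_(i \in A) sqmod (u i - f i).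
    rewrite (fsbig_finite _ _ finA)/=.
    under eq_cvg do rewrite (fsbig_finite _ _ finA)/=.
    apply: cvgS => i.
    have sE (z w : R[i]) : sqmod (z - w) =
      (complex.Re z - complex.Re w) * (complex.Re z - complex.Re w) +
      (complex.Im z - complex.Im w) * (complex.Im z - complex.Im w).
      by case: z w => [a b] [c d].
    rewrite sE /=; under eq_cvg do rewrite sE.
    have cR : (fun v : H => complex.Re (u i) - complex.Re (v i)) @ F -->
        complex.Re (u i) - complex.Re (f i).
      by apply: cvgB; [exact: cvg_cst|exact: cRe].
    have cI : (fun v : H => complex.Im (u i) - complex.Im (v i)) @ F -->
        complex.Im (u i) - complex.Im (f i).
      by apply: cvgB; [exact: cvg_cst|exact: cIm].
    exact: cvgD (cvgM cR cR) (cvgM cI cI).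
  move=> /(cvgr_to_le); apply.
  apply: filterS Fu => v uv.
  apply: le_trans (sum_sqmod_le_norm (u - v) finA) _.
  by rewrite ler_pXn2r ?nnegrE ?ell2_norm_ge0 ?ltW.
have f_ell2 : (f : I -> R[i]^o) \in @ell2_pred R I.
  have [u Fu] := cF 1 ltr01.
  have us : ((fun i => u i - f i) : I -> R[i]^o) \in @ell2_pred R I.
    by apply/ell2_predP; apply: le_lt_trans (key _ _ ltr01 Fu) _; rewrite ltry.
  rewrite (_ : (f : I -> R[i]^o) = (u : I -> R[i]^o) - (fun i => u i - f i)).
    by apply: rpredB => //; case: (u).
  by apply/funext => i; exact/esym/(@subKr R[i] (u i) (f i)).
pose fH : H := Ell2 f_ell2.
apply/cvg_ex; exists fH; apply/cvg_ballP => eps eps0.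
have [e e0 ->] : exists2 e : R, 0 < e & eps = e%:C.
  by exists (complex.Re eps); case: eps eps0 => a b; rewrite ltcE/= => /andP[/eqP b0 a0] //; rewrite b0.
have e20 : 0 < e / 2 by rewrite divr_gt0.
have [u Fu] := cF _ e20.
have uf : ell2_norm (u - fH) <= e / 2.
  have := key _ _ e20 Fu.
  rewrite (_ : (fun i => _) = (fun i => sqmod ((u - fH) i)))//.
  rewrite -[nnsum _]fineK; last first.
    by rewrite nnsum_fin ?ell2_fin// => i; exact: sqmod_ge0.
  rewrite -sqr_ell2_norm lee_fin ler_pXn2r ?nnegrE ?ell2_norm_ge0//.
  exact: ltW.
rewrite ell2_ballE; apply: filterS Fu => v uv /=.
rewrite (_ : fH - v = (u - v) - (u - fH)); last by rewrite opprB [RHS]addrC addrA subrK.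
apply: le_lt_trans (ell2_normD _ _) _; rewrite ell2_normN; lra.
Qed.

HB.instance Definition _ := Uniform_isComplete.Build H ell2_complete.

HB.instance Definition _ := CompleteNormedModule_isHilbert.Build R H
  (@ell2_innerDl R I) (@ell2_innerZl R I) (@ell2_innerC R I) (@ell2_inner_norm R I).

Definition ell2_delta (h : I) : I -> R[i]^o := fun i => (i == h)%:R.

Lemma ell2_delta_subproof h : ell2_delta h \in @ell2_pred R I.
Proof.
apply/ell2_predP.
rewrite (_ : nnsum _ = \esum_(i in [set h]) 1%E)%E; last first.
  rewrite esum_mkcond; apply: eq_esum => i _; rewrite /ell2_delta.
  have -> : (i \in [set h]) = (i == h) by apply/idP/eqP; rewrite inE.
  by case: (i == h); rewrite /sqmod /= ?expr1n ?expr0n/= ?addr0.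
by rewrite esum_set1// ltry.
Qed.

Definition ell2_basis h : H := Ell2 (ell2_delta_subproof h).
End ell2_hilbert.

Section algebraic_dynamical_systems.
Local Open Scope group_scope.

Definition principal_right_ideal (P : monoidType) (p : P) : set P :=
  range (fun x => p * x).

Definition right_LCM (P : monoidType) : Prop :=
  [/\ countable [set: P],
      (forall p : P, injective (fun x => p * x)) &
      forall p q : P,
        principal_right_ideal p `&` principal_right_ideal q = set0 \/
        exists r, principal_right_ideal p `&` principal_right_ideal q =
                  principal_right_ideal r].

Record algebraic_dynamical_system (G : groupType) (P : monoidType)
    (theta : P -> {multiplicative G -> G}) : Prop := {
  ads_countable : countable [set: G];
  ads_right_LCM : right_LCM P;
  ads_theta1 : forall g, theta 1 g = g;
  ads_thetaM : forall p q g, theta (p * q) g = theta p (theta q g);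
  ads_theta_inj : forall p, injective (theta p);
  ads_theta_order : forall p q r,
    principal_right_ideal p `&` principal_right_ideal q =
      principal_right_ideal r ->
    range (theta p) `&` range (theta q) = range (theta r)
}.

Definition directed (P : monoidType) : Prop :=
  forall p q : P, principal_right_ideal p `&` principal_right_ideal q !=set0.

Definition minimal (G : groupType) (P : monoidType)
    (theta : P -> {multiplicative G -> G}) : Prop :=
  \bigcap_(p in [set: P]) range (theta p) = [set 1].

(* The family t picks one element from each left coset of H; H has finite
   index iff such a finite family exists. *)
Definition left_transversal (G : groupType) (H : set G) (n : nat)
    (t : 'I_n -> G) : Prop :=
  forall g, exists! i, H ((t i)^-1 * g).

End algebraic_dynamical_systems.

Local Notation "a ** b" := (cmul a b) (at level 40, left associativity).

Record boundary_relations (R : realType) (G : groupType) (P : monoidType)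
    (theta : P -> {multiplicative G -> G})
    (A : cstarAlgType R) (u : G -> A) (s : P -> A) : Prop := {
  rel_u1 : u 1%g = cone;
  rel_uM : forall g h, u (g * h)%g = u g ** u h;
  rel_u_unitaryl : forall g, star (u g) ** u g = cone;
  rel_u_unitaryr : forall g, u g ** star (u g) = cone;
  rel_s1 : s 1%g = cone;
  rel_sM : forall p q, s (p * q)%g = s p ** s q;
  rel_s_isometry : forall p, star (s p) ** s p = cone;
  rel_I : forall p g, s p ** u g = u (theta p g) ** s p;
  rel_II : forall p q g g1 g2 p' q',
    g = (theta p g1 * theta q g2)%g ->
    principal_right_ideal p `&` principal_right_ideal q =
      principal_right_ideal (p * p')%g ->
    (p * p' = q * q')%g ->
    star (s p) ** u g ** s q = u g1 ** s p' ** star (s q') ** u g2;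
  rel_II_zero : forall p q g,
    ~ (exists g1 g2 p' q',
        [/\ g = (theta p g1 * theta q g2)%g,
            principal_right_ideal p `&` principal_right_ideal q =
              principal_right_ideal (p * p')%g &
            (p * p' = q * q')%g]) ->
    star (s p) ** u g ** s q = 0;
  rel_III : forall p n (t : 'I_n -> G), left_transversal (range (theta p)) t ->
    \sum_(i < n) u (t i) ** s p ** star (s p) ** star (u (t i)) = cone
}.

Definition star_morphism (R : realType) (A B : cstarAlgType R)
    (phi : {linear A -> B}) : Prop :=
  [/\ phi cone = cone,
      (forall a b, phi (a ** b) = phi a ** phi b) &
      forall a, phi (star a) = star (phi a)].

Definition star_subalgebra (R : realType) (A : cstarAlgType R) (B : set A) :
    Prop :=
  [/\ B cone,
      (forall (c : R[i]) a b, B a -> B b -> B (c *: a + b)),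
      (forall a b, B a -> B b -> B (a ** b)) &
      forall a, B a -> B (star a)].

(* (Q, u, s) is the universal C*-algebra generated by the relations; the
   morphism phi is unique because u and s generate Q. *)
Record is_boundary_quotient (R : realType) (G : groupType) (P : monoidType)
    (theta : P -> {multiplicative G -> G})
    (Q : cstarAlgType R) (u : G -> Q) (s : P -> Q) : Prop := {
  bq_relations : boundary_relations theta u s;
  bq_generated : forall B : set Q, closed B -> star_subalgebra B ->
    (forall g, B (u g)) -> (forall p, B (s p)) -> B = setT;
  bq_universal : forall (A : cstarAlgType R) (u' : G -> A) (s' : P -> A),
    boundary_relations theta u' s' ->
    exists phi : {linear Q -> A},
      [/\ star_morphism phi, forall g, phi (u g) = u' g &
          forall p, phi (s p) = s' p]
}.

(* Unital *-homomorphisms from A to the bounded operators on H. *)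
Record is_representation (R : realType) (A : cstarAlgType R)
    (H : hilbertType R) (pi : A -> {linear H -> H}) : Prop := {
  rep_bounded : forall a, continuous (pi a);
  rep_linear : forall (c : R[i]) a b x,
    pi (c *: a + b) x = c *: pi a x + pi b x;
  rep1 : forall x, pi cone x = x;
  repM : forall a b x, pi (a ** b) x = pi a (pi b x);
  rep_star : forall a x y, inner (pi a x) y = inner x (pi (star a) y)
}.

Definition irreducible (R : realType) (A : cstarAlgType R)
    (H : hilbertType R) (pi : A -> {linear H -> H}) : Prop :=
  (exists x : H, x != 0) /\
  forall V : set H, closed V -> V 0 ->
    (forall (c : R[i]) x y, V x -> V y -> V (c *: x + y)) ->
    (forall a x, V x -> V (pi a x)) ->
    V = [set 0] \/ V = setT.

Definition is_canonical_representation (R : realType) (G : groupType)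
    (P : monoidType) (theta : P -> {multiplicative G -> G})
    (Q : cstarAlgType R) (u : G -> Q) (s : P -> Q)
    (pi : Q -> {linear ell2 R G -> ell2 R G}) : Prop :=
  is_representation pi /\
  forall g p h,
    pi (u g ** s p) (ell2_basis R h) = ell2_basis R (g * theta p h)%g.

(* Main.v *)
Require Import Defs.
From mathcomp Require Import all_boot all_order all_algebra.
From mathcomp Require Import complex finmap.
From mathcomp Require Import boolp classical_sets cardinality fsbigop.
From mathcomp Require Import reals ereal topology normedtype esum.

(** Let V be a nonzero closed subspace of ell^2(G) invariant under pi.  For p
    in P the element s_p s_p^* is a projection, and pi maps it to the
    orthogonal projection E_p onto ell^2(theta_p(G)), the multiplication by
    the indicator function of theta_p(G) ([canonical_range_projection]).
    Since P is directed, the subgroups theta_p(G) form a downward directed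
    family; since the system is minimal, their intersection is trivial.
    Hence any finite subset of G meets some theta_p(G) in at most the unit
    ([minimal_separates_finite]), and, as almost all of the norm of a
    square-summable x sits on a finite set ([ell2_tail]), E_p x comes
    arbitrarily close to x(1) xi_1.

    A nonzero x in V has x(h) <> 0 for some h, and translating it by
    pi(u_{h^-1}) gives an element of V whose value at 1 is nonzero.  By the
    previous paragraph the closed subspace V contains xi_1
    ([invariant_vacuum]), hence every xi_g = pi(u_g) xi_1, and these span a
    dense subspace ([dense_basis]). *)

Set Implicit Arguments.
Unset Strict Implicit.
Unset Printing Implicit Defensive.

(** * Coordinates and tails in ell^2 *)

Section ell2_theory.
Import Order.TTheory GRing.Theory Num.Theory.
Local Open Scope classical_set_scope.
Local Open Scope ring_scope.
Local Open Scope complex_scope.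
Variables (R : realType) (I : choiceType).
Implicit Types (x y v : ell2 R I) (h : I) (c : R) (e : R).

Lemma ell2_basisE h i : ell2_basis R h i = (i == h)%:R.
Proof. by []. Qed.

Lemma ell2P x y : (forall i, x i = y i) -> x = y.
Proof. by move=> xy; apply/val_inj/funext => i; exact: xy. Qed.

Lemma sqmod0 : sqmod (0 : R[i]) = 0.
Proof. by rewrite /sqmod/= expr0n addr0. Qed.

Lemma nnsum_single h c : 0 <= c ->
  nnsum (fun i => if i == h then c else 0) = c%:E.
Proof.
move=> c0; rewrite -(@esum_set1 _ _ h (fun=> c%:E)) ?lee_fin// esum_mkcond.
apply: eq_esum => i _.
have -> : (i \in [set h]) = (i == h) by apply/idP/eqP; rewrite inE.
by case: eqP.
Qed.

Lemma rsum_single h c : rsum (fun i => if i == h then c else 0) = c.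
Proof.
have max0 (d : R) : 0 <= Num.max d 0 by rewrite le_max lexx orbT.
have single0 (d : R) i : 0 <= (if i == h then Num.max d 0 else 0) by case: ifP.
have maxB : Num.max c 0 - Num.max (- c) 0 = c.
  have [c0|c0] := leP 0 c; first by rewrite max_r ?oppr_le0// subr0.
  by rewrite max_l ?sub0r ?opprK// oppr_ge0 ltW.
rewrite (rsum_decomp (single0 c) (single0 (- c))) ?nnsum_single ?ltry//=.
by move=> i; case: eqP => _; rewrite ?subr0// maxB.
Qed.

(** This turns the adjoint relation of a representation into formulas for the
    coordinates of the image of a vector. *)
Lemma inner_basis x h : inner x (ell2_basis R h) = x h.
Proof.
rewrite [LHS]ell2_innerE.
have bE (a b : R) i : a * complex.Re (ell2_basis R h i) +
    b * complex.Im (ell2_basis R h i) = if i == h then a else 0.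
  by rewrite ell2_basisE; case: (i == h) => /=; rewrite ?mulr1 ?mulr0 ?addr0.
rewrite (_ : (fun i => _) =
    (fun i => if i == h then complex.Re (x h) else 0)); last first.
  by apply/funext => i; rewrite bE; case: eqP => // ->.
rewrite (_ : (fun i => complex.Im _ * _ - _) =
    (fun i => if i == h then complex.Im (x h) else 0)); last first.
  by apply/funext => i; rewrite -mulNr bE; case: eqP => // ->.
by rewrite !rsum_single; case: (x h).
Qed.

Lemma inner_coord0 x y :
  (forall h, inner x (ell2_basis R h) = 0) -> inner y x = 0.
Proof.
move=> x0; have -> : x = 0 by apply: ell2P => i; rewrite -inner_basis x0.
by rewrite innerC -(scale0r (0 : ell2 R I)) innerZl mul0r conjC0.
Qed.

(** The finite set carries all of the squared norm of x but e^2, so a vector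
    dominated by x and vanishing on that set has squared norm below e^2.  The
    choice of the set before v is what lets the projections E_p be
    estimated uniformly: p is chosen afterwards, depending on the set. *)
Lemma ell2_tail x e : 0 < e -> exists2 F : set I, finite_set F &
  forall v, (forall i, F i -> v i = 0) ->
    (forall i, sqmod (v i) <= sqmod (x i)) -> ell2_norm v < e.
Proof.
move=> e0; have sq0 y i : 0 <= sqmod (y i) := sqmod_ge0 (y i).
have xfin : nnsum (fun i => sqmod (x i)) \is a fin_num.
  by rewrite nnsum_fin ?ell2_fin.
have e20 : 0 < e ^+ 2 by rewrite exprn_gt0.
have [_ [F [finF _] <-] Fx] := ub_ereal_sup_adherent e20 xfin.
exists F => // v vF vx.
rewrite -(@ltr_pXn2r _ 2)// ?nnegrE ?ell2_norm_ge0 ?ltW// sqr_ell2_norm.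
have vfin : nnsum (fun i => sqmod (v i)) \is a fin_num.
  by rewrite nnsum_fin ?ell2_fin.
have : (nnsum (fun i => sqmod (v i)) + \sum_(i \in F) (sqmod (x i))%:E <=
    nnsum (fun i => sqmod (x i)))%E.
  rewrite -esum_fset//; last by move=> i _; rewrite lee_fin.
  rewrite esum_mkcond.
  rewrite (_ : esum _ _ = nnsum (fun i => if i \in F then sqmod (x i) else 0)).
    rewrite -nnsumD//; last by move=> i; case: ifP.
    apply: le_nnsum => i.
    case: ifPn => [/set_mem/vF ->|_]; last by rewrite addr0.
    by rewrite sqmod0 add0r.
  by apply: eq_esum => i _; case: ifP.
rewrite -lte_fin fineK// => le_x.
rewrite -(@lteD2rE _ (\sum_(i \in F) (sqmod (x i))%:E)%E); last first.
  by rewrite fsumEFin.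
apply: le_lt_trans le_x _.
by rewrite addeC -lteBlDr.
Qed.

Lemma closed_ell2P (V : set (ell2 R I)) x : closed V ->
  (forall e, 0 < e -> exists2 v, V v & ell2_norm (x - v) < e) -> V x.
Proof.
move=> cV Vx; apply: cV => B /nbhs_ballP[eps eps0].
have [e e0 ->] : exists2 e : R, 0 < e & eps = e%:C.
  move: eps0 => /=; rewrite ltcE/= => /andP[/eqP eps_im eps_re].
  exists (complex.Re eps) => //.
  by apply/eqP; rewrite eq_complex/= eps_im !eqxx.
rewrite ell2_ballE => xB; have [v Vv /xB Bv] := Vx _ e0.
by exists v.
Qed.

(** The restriction of x to a finite set is a combination of basis vectors, and
    what remains of x is a tail in the sense of [ell2_tail]. *)
Lemma dense_basis (V : set (ell2 R I)) : closed V -> V 0 ->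
  (forall a x y, V x -> V y -> V (a *: x + y)) ->
  (forall h, V (ell2_basis R h)) -> V = setT.
Proof.
move=> cV V0 linV Vb; apply/seteqP; split => // x _.
apply: closed_ell2P => // e e0; have [F finF Fx] := ell2_tail x e0.
have xF (r : seq I) : uniq r -> exists2 v, V v &
    forall i, v i = if i \in r then x i else 0.
  elim: r => [_|h r IH /= /andP[hr /IH[v Vv vE]]]; first by exists 0.
  exists (x h *: ell2_basis R h + v); first exact: linV.
  move=> i; rewrite ell2D ell2Z ell2_basisE inE vE.
  case: eqVneq => [->|_]; first by rewrite (negbTE hr) mulr1 addr0.
  by rewrite mulr0 add0r.
have [v Vv vE] := xF _ (fset_uniq (fset_set F)).
have xvE i : (x - v) i = if i \in fset_set F then 0 else x i.
  rewrite [LHS](_ : _ = x i - v i)// vE.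
  by case: ifP; rewrite ?subrr ?subr0.
exists v => //; apply: Fx => i; rewrite xvE in_fset_set//.
  by move=> /mem_set ->.
by case: ifP => // _; rewrite sqmod0 sqmod_ge0.
Qed.

(** An isometry T permuting basis vectors along f has T T^* diagonal: the
    adjoint S sends the basis vector at f k back to the one at k, because
    S T = 1, and kills the basis vector at h outside the range of f, because
    that vector is orthogonal to every T xi_k. *)
Lemma range_projection_coord (f : I -> I) (T S : ell2 R I -> ell2 R I) x h :
  (forall y z, inner (T y) z = inner y (S z)) ->
  (forall y z, inner (S y) z = inner y (T z)) ->
  cancel T S -> (forall k, T (ell2_basis R k) = ell2_basis R (f k)) ->
  T (S x) h = if h \in range f then x h else 0.
Proof.
move=> TS ST TK Tb; rewrite -inner_basis TS.
case: ifPn => [/set_mem[k _ <-]|hf]; first by rewrite -Tb TK ST Tb inner_basis.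
apply: inner_coord0 => k; rewrite ST Tb inner_basis ell2_basisE.
case: eqP => // fk; move: hf; rewrite notin_setE => -[].
by exists k.
Qed.

End ell2_theory.

(** * The subgroups theta_p(G) *)

Section images.
Local Open Scope classical_set_scope.
Local Open Scope group_scope.
Variables (G : groupType) (P : monoidType).
Variable theta : P -> {multiplicative G -> G}.

Lemma theta_unit p : theta p 1 = 1.
Proof. by apply: (@mulgI _ (theta p 1)); rewrite -gmulfM !mulg1. Qed.

(** A common right multiple r = p a = q b gives theta_r = theta_p theta_a =
    theta_q theta_b. *)
Lemma range_theta_lower_bound p q : algebraic_dynamical_system theta ->
  directed P ->
  exists r, range (theta r) `<=` range (theta p) `&` range (theta q).
Proof.
move=> hads /(_ p q)[r [[a _ ar] [b _ br]]]; exists r => g [k _ <-]; split.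
  by exists (theta a k) => //; rewrite -(ads_thetaM hads) ar.
by exists (theta b k) => //; rewrite -(ads_thetaM hads) br.
Qed.

(** Each g <> 1 is avoided by some theta_q(G) by minimality; directedness
    replaces the finitely many q by a single p. *)
Lemma minimal_separates_finite (F : set G) : algebraic_dynamical_system theta ->
  directed P -> minimal theta -> finite_set F ->
  exists p, forall g, F g -> range (theta p) g -> g = 1.
Proof.
move=> hads hdir hmin /finite_seqP[r ->]; elim: r => [|g r [p IH]].
  by exists 1.
have [q gq] : exists q, range (theta q) g -> g = 1.
  have [->|g1] := eqVneq g 1; first by exists 1.
  apply: contrapT => /forallNP nq; have : [set 1] g; last by move/eqP: g1.
  by rewrite -hmin => q _; apply: contrapT => gq; apply: (nq q).
have [z zpq] := range_theta_lower_bound p q hads hdir.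
exists z => k /=; rewrite inE => /orP[/eqP ->|kr] /zpq[kp kq]; first exact: gq.
exact: IH.
Qed.

End images.

(** * Closed invariant subspaces of the canonical representation *)

Section vacuum.
Import GRing.Theory Num.Theory.
Local Open Scope classical_set_scope.
Local Open Scope ring_scope.
Variables (R : realType) (G : groupType) (P : monoidType).
Variable theta : P -> {multiplicative G -> G}.
Hypotheses (hads : algebraic_dynamical_system theta) (hdir : directed P).
Hypothesis hmin : minimal theta.
Variables (Q : cstarAlgType R) (u : G -> Q) (s : P -> Q).
Hypothesis hrel : boundary_relations theta u s.
Variable pi : Q -> {linear ell2 R G -> ell2 R G}.
Hypothesis hpi : is_canonical_representation theta u s pi.

Lemma canonical_u g h : pi (u g) (ell2_basis R h) = ell2_basis R (g * h)%g.
Proof.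
have [_ /(_ g 1%g h)] := hpi.
by rewrite (rel_s1 hrel) cmulx1 (ads_theta1 hads).
Qed.

Lemma canonical_s p h : pi (s p) (ell2_basis R h) = ell2_basis R (theta p h).
Proof.
have [_ /(_ 1%g p h)] := hpi.
by rewrite (rel_u1 hrel) cmul1x mul1g.
Qed.

(** The adjoint of the unitary pi(u_g) is its inverse. *)
Lemma canonical_u_coord g x h : pi (u g) x (g * h)%g = x h.
Proof.
have [rep _] := hpi.
rewrite -inner_basis (rep_star rep) -canonical_u -(repM rep).
by rewrite (rel_u_unitaryl hrel) (rep1 rep) inner_basis.
Qed.

Lemma canonical_range_projection p x h :
  pi (cmul (s p) (star (s p))) x h = if h \in range (theta p) then x h else 0.
Proof.
have [rep _] := hpi; rewrite (repM rep).
apply: (@range_projection_coord R G (theta p) (pi (s p)) (pi (star (s p)))).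
- by move=> y z; rewrite (rep_star rep).
- by move=> y z; rewrite (rep_star rep) starK.
- by move=> y; rewrite -(repM rep) (rel_s_isometry hrel) (rep1 rep).
- exact: canonical_s.
Qed.

Variable V : set (ell2 R G).
Hypotheses (closedV : closed V) (V0 : V 0).
Hypothesis linV : forall (c : R[i]) x y, V x -> V y -> V (c *: x + y).
Hypothesis invV : forall a x, V x -> V (pi a x).

(** E_p x - x(1) xi_1 is x restricted to the nontrivial elements of
    theta_p(G), which vanishes on any prescribed finite set once p is
    suitable. *)
Lemma invariant_vacuum x : V x -> x 1%g != 0 -> V (ell2_basis R 1%g).
Proof.
move=> Vx x1; suff Vx1 : V (x 1%g *: ell2_basis R 1%g).
  have := linV (x 1%g)^-1 Vx1 V0.
  by rewrite addr0 scalerA mulVf// scale1r.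
apply: closed_ell2P => // e e0; have [F finF Fx] := @ell2_tail R G x e e0.
have [p pF] := minimal_separates_finite hads hdir hmin finF.
exists (pi (cmul (s p) (star (s p))) x); first exact: invV.
rewrite -ell2_normN opprB.
have dE h : (pi (cmul (s p) (star (s p))) x - x 1%g *: ell2_basis R 1%g) h =
    if (h \in range (theta p)) && (h != 1%g) then x h else 0.
  rewrite [LHS](_ : _ = pi (cmul (s p) (star (s p))) x h -
    x 1%g * ell2_basis R 1%g h)// canonical_range_projection ell2_basisE.
  case: eqVneq => [->|_] /=; last by rewrite mulr0 subr0 andbT.
  (* At the unit, which lies in theta_p(G), the two terms cancel. *)
  rewrite andbF mulr1 mem_set ?subrr//.
  by exists 1%g; rewrite ?theta_unit.
apply: Fx => h; rewrite dE.
  by move=> /pF hF; case: ifP => // /andP[/set_mem/hF ->]; rewrite eqxx.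
by case: ifP => // _; rewrite sqmod0 sqmod_ge0.
Qed.

(** Translating by the inverse of a point of the support of x makes
    [invariant_vacuum] applicable; the translates of xi_1 are then all the
    basis vectors. *)
Lemma invariant_full x : V x -> x != 0 -> V = setT.
Proof.
move=> Vx x0; have [h xh] : exists h, x h != 0.
  apply: contrapT => /forallNP xh; move/eqP: x0; apply; apply: ell2P => h.
  by apply/eqP/negPn/negP/xh.
apply: dense_basis => // g; rewrite -[g]mulg1 -canonical_u; apply: invV.
apply: (@invariant_vacuum (pi (u h^-1%g) x)); first exact: invV.
by rewrite -(mulVg h) canonical_u_coord.
Qed.

End vacuum.

Theorem proposition2p3 (R : realType) (G : groupType) (P : monoidType)
    (theta : P -> {multiplicative G -> G})
    (hads : algebraic_dynamical_system theta)
    (hdir : directed P)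
    (hmin : minimal theta)
    (Q : cstarAlgType R) (u : G -> Q) (s : P -> Q)
    (hQ : is_boundary_quotient theta u s)
    (pi : Q -> {linear ell2 R G -> ell2 R G})
    (hpi : is_canonical_representation theta u s pi) :
  irreducible pi.
Proof.
split.
  exists (ell2_basis R 1%g); apply/eqP => /(congr1 (fun x : ell2 R G => x 1%g)).
  by rewrite ell2_basisE eqxx => /eqP; rewrite GRing.oner_eq0.
move=> V closedV V0 linV invV.
have [V_eq0|/existsNP[x /not_implyP[Vx /eqP x0]]] :=
  pselect (forall x, V x -> x = GRing.zero).
  by left; apply/seteqP; split => x /= => [/V_eq0|->].
right.
exact (invariant_full hads hdir hmin (bq_relations hQ) hpi closedV V0
  linV invV Vx x0).
Qed.
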